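(* Let $r\ge 1$ be an integer, let $a_1,\dots,a_r$ be non-zero $p$-adic integers, let $w\in\mathbb{Z}_p$, let $u\in\mathbb{C}_p$ satisfy $|1-u^f|_p\ge 1$ for every positive integer $f$, and let $q\in\mathbb{C}_p$ satisfy $q\neq 1$ and $|1-q|_p<p^{-1/(p-1)}$. Then for every integer $n\ge 0$, $$H_n^{(r)}(w,u,q\,|\,a_1,\dots,a_r)=\frac{(1-u)^r}{(1-q)^n}\sum_{l=0}^n\binom{n}{l}(-1)^l q^{lw}\,\frac{1}{\prod_{j=1}^r(1-q^{la_j}u)}.$$ Moreover, if $u\ne 0$, then $$\lim_{q\to 1}H_n^{(r)}(w,u,q\,|\,a_1,\dots,a_r)=H_n^{(r)}(w,u^{-1}\,|\,a_1,\dots,a_r),$$ where the limit is taken in $\mathbb{C}_p$ over $q\ne 1$ with $|1-q|_p<p^{-1/(p-1)}$.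
   Context: Fix a prime $p$. $\mathbb{C}_p$ is the completion of an algebraic closure of $\mathbb{Q}_p$, with absolute value normalized by $|p|_p=p^{-1}$. For $q\in\mathbb{C}_p$ with $|1-q|_p<p^{-1/(p-1)}$ and $x\in\mathbb{Z}_p$, put $q^x=\exp(x\log q)$ ($p$-adic $\exp$ and $\log$), and for $q\neq1$ put $[x:q]=\frac{1-q^x}{1-q}$. For a nonnegative integer $M$ and $z\in\mathbb{C}_p$, $z\ne1$, put $[M:z]=\frac{1-z^M}{1-z}$. The $q$-analogue of the Euler-Barnes polynomials is defined by the $p$-adic integral $$H_n^{(r)}(w,u,q\,|\,a_1,\dots,a_r)=\int_{\mathbb{Z}_p}\cdots\int_{\mathbb{Z}_p}\Big[w+\sum_{j=1}^r a_jx_j:q\Big]^n d\mu_u(x_1)\cdots d\mu_u(x_r)$$ ($r$ integrals), which means $$\lim_{N\to\infty}\frac{1}{[p^N:u]^r}\sum_{x_1,\dots,x_r=0}^{p^N-1}\Big[w+\sum_{j=1}^r a_jx_j:q\Big]^n u^{x_1+\cdots+x_r}.$$ The (ordinary) Euler-Barnes polynomials $H_n^{(r)}(w,v\,|\,a_1,\dots,a_r)$, with parameter $v\neq 1$, are defined by the generating function (formal power series in $t$, here over $\mathbb{C}_p$) $$\frac{(1-v)^r}{\prod_{j=1}^r(e^{a_jt}-v)}\,e^{wt}=\sum_{n=0}^\infty H_n^{(r)}(w,v\,|\,a_1,\dots,a_r)\frac{t^n}{n!}.$$ *)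

(* Defs.v *)
From HB Require Import structures.
From mathcomp Require Import all_boot all_order all_algebra.
From mathcomp Require Import all_classical all_reals all_analysis.

Set Implicit Arguments.
Unset Strict Implicit.
Unset Printing Implicit Defensive.

Import Order.TTheory GRing.Theory Num.Theory.
Local Open Scope classical_set_scope.
Local Open Scope ring_scope.

(* [normedZmodType] cannot carry a p-adic absolute value: it demands
   [`|x *+ n| = `|x| *+ n].  Hence a separate structure of fields with a
   non-archimedean absolute value, given its metric topology below. *)
HB.mixin Record Field_isValued (R : realType) K of GRing.Field K := {
  vabs : K -> R;
  vabs_ge0 : forall x, 0 <= vabs x;
  vabs_eq0 : forall x, (vabs x == 0) = (x == 0);
  vabsM : forall x y, vabs (x * y) = vabs x * vabs y;
  vabsD : forall x y, vabs (x + y) <= Num.max (vabs x) (vabs y) }.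

#[short(type="valuedFieldType")]
HB.structure Definition ValuedField (R : realType) :=
  {K of GRing.Field K & Field_isValued R K}.

Section ValuedFieldTopology.
Variables (R : realType) (K : valuedFieldType R).
Implicit Types x y z : K.

Definition vdist x y : R := vabs (x - y).

Local Fact vdistxx x : vdist x x = 0.
Proof. by apply/eqP; rewrite /vdist vabs_eq0 subrr. Qed.

Local Fact vdist_positivity x y : vdist x y = 0 -> x = y.
Proof. by move/eqP; rewrite vabs_eq0 subr_eq0 => /eqP. Qed.

Local Fact vabsN1 : vabs (-1 : K) = 1.
Proof.
have sq1 z : z * z = 1 -> vabs (z * z) = 1 -> vabs z = 1.
  by move=> _; rewrite vabsM -expr2 => /eqP; rewrite sqrp_eq1 ?vabs_ge0// => /eqP.
apply: sq1; rewrite mulrNN mulr1 //.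
have /mulfI : vabs (1 : K) != 0 by rewrite vabs_eq0 oner_neq0.
by apply; rewrite -vabsM !mulr1.
Qed.

Local Fact vdist_sym x y : vdist x y = vdist y x.
Proof. by rewrite /vdist -opprB -mulN1r vabsM vabsN1 mul1r. Qed.

Local Fact vdist_triangle y x z : vdist x z <= vdist x y + vdist y z.
Proof.
rewrite /vdist -[x - z](subrKA y); apply: le_trans (vabsD _ _) _.
by rewrite ge_max lerDl lerDr !vabs_ge0.
Qed.

HB.instance Definition _ := isPointed.Build (ValuedField.sort K) 0.
HB.instance Definition _ := isMetric.Build R (ValuedField.sort K)
  vdistxx vdist_positivity vdist_sym vdist_triangle.

End ValuedFieldTopology.

(* In a complete [K] with [vabs p = 1/p] this is Q_p: the closure of Q in [K]
   is the completion of Q for its p-adic absolute value. *)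
Definition padic_rat {R : realType} {K : valuedFieldType R} : set K :=
  closure (range (ratr : rat -> K)).

Definition padic_int {R : realType} {K : valuedFieldType R} : set K :=
  padic_rat `&` [set x | vabs x <= 1].

Definition padic_alg {R : realType} {K : valuedFieldType R} : set K :=
  [set x | exists P : {poly K},
     [/\ P != 0, forall i, padic_rat P`_i & root P x]].

(* [K] is the completion of an algebraic closure of Q_p; this determines it up
   to isometric isomorphism. *)
Record is_Cp (R : realType) (p : nat) (K : valuedFieldType R) : Prop := {
  Cp_absp : vabs (p%:R : K) = p%:R^-1;
  Cp_complete : forall F : set_system K, ProperFilter F -> cauchy F -> cvg F;
  Cp_alg_closed : forall P : {poly K}, (forall i, padic_alg P`_i) ->
    (1 < size P)%N -> exists2 x : K, padic_alg x & root P x;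
  Cp_alg_dense : dense (padic_alg : set K) }.

Definition exp_radius (R : realType) (p : nat) : R :=
  p%:R `^ (- (p.-1)%:R^-1).

Section QAnalogue.
Context {R : realType} {K : valuedFieldType R}.
Implicit Types (q x u w z : K) (p n M N r : nat).

Definition padic_exp x : K :=
  limn (fun N => \sum_(n < N) x ^+ n / n`!%:R).

Definition padic_log x : K :=
  limn (fun N => \sum_(n < N) (-1) ^+ n * (x - 1) ^+ n.+1 / n.+1%:R).

Definition padic_pow q x : K := padic_exp (x * padic_log q).

Definition qbracket x q : K := (1 - padic_pow q x) / (1 - q).

Definition nat_bracket M z : K := (1 - z ^+ M) / (1 - z).

Definition mu_sum p r u (g : ('I_r -> K) -> K) N : K :=
  (nat_bracket (p ^ N) u ^+ r)^-1 *
  \sum_(x : {ffun 'I_r -> 'I_(p ^ N)})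
     g (fun j => (x j)%:R) * u ^+ (\sum_(j < r) x j)%N.

Definition mu_integral p r u (g : ('I_r -> K) -> K) : K :=
  limn (mu_sum p u g).

Definition qEulerBarnes_integrand r n w q (a x : 'I_r -> K) : K :=
  qbracket (w + \sum_(j < r) a j * x j) q ^+ n.

Definition qEulerBarnes p r n w u q (a : 'I_r -> K) : K :=
  mu_integral p u (qEulerBarnes_integrand n w q a).

End QAnalogue.

(* Formal power series: [f : fps F] is its sequence of coefficients, with the
   Cauchy product.  The alias keeps this ring structure apart from the
   pointwise one on [nat -> F]. *)
Definition fps (F : fieldType) := nat -> F.

Section FPS.
Variable F : fieldType.
Implicit Types f g h : fps F.

HB.instance Definition _ := GRing.Zmodule.copy (fps F) (nat -> F).

Definition fps_const (c : F) : fps F := fun n => if n == 0%N then c else 0.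

Definition fps_mul f g : fps F :=
  fun n => \sum_(i < n.+1) f i * g (n - i)%N.

Local Definition trunc N f : {poly F} := \poly_(i < N.+1) f i.

Local Fact truncE N f n : (n <= N)%N -> (trunc N f)`_n = f n.
Proof. by move=> nN; rewrite coef_poly ltnS nN. Qed.

Local Fact trunc_mulE N f g n : (n <= N)%N ->
  (trunc N f * trunc N g)`_n = fps_mul f g n.
Proof.
move=> nN; rewrite coefM; apply: eq_bigr => i _.
rewrite !truncE //; first exact: leq_trans (leq_subr _ _) nN.
exact: leq_trans (leq_ord i) nN.
Qed.

Local Fact fps_mulA : associative fps_mul.
Proof.
move=> f g h; apply/funext => n.
transitivity ((trunc n f * (trunc n g * trunc n h))`_n).
  rewrite coefM; apply: eq_bigr => i _.
  rewrite truncE; last exact: leq_ord.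
  by rewrite trunc_mulE // leq_subr.
rewrite mulrA coefM; apply: eq_bigr => i _.
rewrite trunc_mulE; last exact: leq_ord.
by rewrite truncE // leq_subr.
Qed.

Local Fact fps_mulC : commutative fps_mul.
Proof.
move=> f g; apply/funext => n.
by rewrite -!(@trunc_mulE n) // mulrC.
Qed.

Local Fact fps_mul1 : left_id (fps_const 1) fps_mul.
Proof.
move=> f; apply/funext => n; rewrite /fps_mul big_ord_recl big1 => [|i _].
  by rewrite /fps_const eqxx mul1r subn0 addr0.
by rewrite /fps_const mul0r.
Qed.

Local Fact fps_mulDl : left_distributive fps_mul +%R.
Proof.
move=> f g h; apply/funext => n.
rewrite [RHS]/GRing.add /= /fps_mul -big_split /=.
by apply: eq_bigr => i _; rewrite -mulrDl.
Qed.

Local Fact fps_1neq0 : fps_const 1 != 0.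
Proof.
apply/eqP => /(congr1 (fun f : fps F => f 0%N)) /eqP.
by rewrite /fps_const eqxx (oner_eq0 F).
Qed.

HB.instance Definition _ := GRing.Zmodule_isComNzRing.Build (fps F)
  fps_mulA fps_mulC fps_mul1 fps_mulDl fps_1neq0.

(* The first [n] coefficients of the inverse of [f]: in degree [m] the equation
   [g * f = 1] determines [g m] from the lower coefficients. *)
Fixpoint fps_inv_prefix f (n : nat) : seq F :=
  if n is m.+1 then
    let s := fps_inv_prefix f m in
    rcons s (((m == 0%N)%:R - \sum_(i < m) s`_i * f (m - i)%N) / f 0%N)
  else [::].

Definition fps_unit : {pred fps F} := [pred f : fps F | f 0%N != 0].

Definition fps_inv f : fps F :=
  if f \in fps_unit then fun n => (fps_inv_prefix f n.+1)`_n else f.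

Local Fact size_inv_prefix f n : size (fps_inv_prefix f n) = n.
Proof. by elim: n => //= n IHn; rewrite size_rcons IHn. Qed.

Local Fact nth_inv_prefix f n m : (n < m)%N ->
  (fps_inv_prefix f m)`_n = (fps_inv_prefix f n.+1)`_n.
Proof.
elim: m => // m IHm; rewrite ltnS leq_eqVlt => /orP[/eqP-> //|nm].
by rewrite -IHm //= nth_rcons size_inv_prefix nm.
Qed.

Local Fact fps_mulVf : {in fps_unit, left_inverse 1 fps_inv *%R}.
Proof.
move=> f uf; apply/funext => n.
rewrite /GRing.mul /= /fps_mul big_ord_recr /= subnn /fps_inv uf.
rewrite [X in _ + X * _]/= nth_rcons size_inv_prefix ltnn eqxx divfK //.
rewrite [X in X + _](_ : _ =
    \sum_(i < n) (fps_inv_prefix f n)`_i * f (n - i)%N).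
  by rewrite addrC subrK [RHS]/GRing.one /= /fps_const; case: eqP.
by apply: eq_bigr => i _; rewrite (nth_inv_prefix _ (ltn_ord i)).
Qed.

Local Fact fps_unitP f g : g * f = 1 -> fps_unit f.
Proof.
move=> /(congr1 (fun h : fps F => h 0%N)).
rewrite /GRing.mul /GRing.one /= /fps_mul /fps_const eqxx big_ord1 subn0.
move=> gf; apply/eqP => f0.
by move/eqP: gf; rewrite f0 mulr0 eq_sym (oner_eq0 F).
Qed.

Local Fact fps_inv_out : {in [predC fps_unit], fps_inv =1 id}.
Proof. by move=> f; rewrite inE /fps_inv => /negbTE ->. Qed.

HB.instance Definition _ := GRing.ComNzRing_hasMulInverse.Build (fps F)
  fps_mulVf fps_unitP fps_inv_out.

Definition fps_coef (n : nat) f : F := f n.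

Definition fps_exp (a : F) : fps F := fun n => a ^+ n / n`!%:R.

(* [n! [t^n]] of the generating series; the denominator is a unit of [fps F]
   when [v != 1]. *)
Definition EulerBarnes (r n : nat) (w v : F) (a : 'I_r -> F) : F :=
  n`!%:R * fps_coef n
    (fps_const ((1 - v) ^+ r) / \prod_(j < r) (fps_exp (a j) - fps_const v)
     * fps_exp w).

End FPS.

(* Main.v *)
Require Import Defs.
From HB Require Import structures.
From mathcomp Require Import all_boot all_order all_algebra.
From mathcomp Require Import all_classical all_reals all_analysis.
From mathcomp Require Import ring lra zify.

Set Implicit Arguments.
Unset Strict Implicit.
Unset Printing Implicit Defensive.

Import Order.TTheory GRing.Theory Num.Theory.
Import numFieldNormedType.Exports.
Local Open Scope classical_set_scope.
Local Open Scope ring_scope.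

(** Let [M = p ^ N]. The Riemann sums of [mu_u] applied to a product of
    exponentials [x |-> prod_j (z j) ^ (x j)] split into geometric sums: such a
    sum is the product over [j] of

      [(1 - u) / (1 - z j u) * ((1 - (z j u) ^ M) / (1 - u ^ M))].

    The last factor differs from 1 by
    [(1 - (z j) ^ M) * (u ^ M / (1 - u ^ M))], where the hypothesis on [u] gives
    [|u ^ M / (1 - u ^ M)| <= 1]; so it tends to 1 as soon as [(z j) ^ M] does.

    Explicit formula. Since [q ^ x] is additive in [x], the binomial expansion
    turns the [n]-th power of the bracket of [w + sum_j (a j) (x j)] into a
    combination of [n + 1] products of exponentials with
    [z j = q ^ (l (a j))]. Each [z j] lies at distance less than 1 from 1, and
    [(z j) ^ M = exp (M l (a j) log q)] tends to 1
    ([mu_sum_exponential_cvg], [qEulerBarnes_sum_cvg]).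

    Limit at [q = 1]. Put [rho = p ^ (- 1 / (p - 1))]. Legendre's formula gives
    [|n!| >= rho ^ (n - 1)], hence [exp y = 1 + y + O(|y| ^ 2 / rho)] and
    [log q = (q - 1) + O(|1 - q| ^ 2 / rho)], so that the bracket of [x] differs
    from [x] by at most [|1 - q| / rho], uniformly for [|x| <= 1]
    ([qbracket_le]). The weights of [mu_u] have absolute value at most 1
    ([mu_sumB_le]); by the ultrametric inequality the q-analogue is therefore
    within [|1 - q| / rho] of the limit of the Riemann sums of
    [(w + sum_j (a j) (x j)) ^ n] ([qEulerBarnes_le]).

    That limit is found by the same geometric sum, now over formal power series
    in [t]: [(w + sum_j (a j) (x j)) ^ n] is [n!] times the coefficient of
    [t ^ n] in [e ^ (w t) * prod_j (e ^ (a j t)) ^ (x j)], and coefficientwise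
    the correction factors tend to 1 again ([mu_sum_power_cvg]). What remains is
    [e ^ (w t) * prod_j (1 - u) / (1 - u e ^ (a j t))], the generating series of
    the Euler-Barnes polynomials with parameter [u^-1]. *)

(** * Ultrametric absolute values and limits *)

Section UltrametricAbsoluteValue.
Context {R : realType} {K : valuedFieldType R}.
Implicit Types x y : K.

Lemma vabs0 : vabs (0 : K) = 0.
Proof. by apply/eqP; rewrite vabs_eq0. Qed.

Lemma vabs1 : vabs (1 : K) = 1.
Proof.
have /mulfI : vabs (1 : K) != 0 by rewrite vabs_eq0 oner_neq0.
by apply; rewrite -vabsM !mulr1.
Qed.

Lemma vabsN x : vabs (- x) = vabs x.
Proof. by rewrite -mulN1r vabsM Defs.vabsN1 mul1r. Qed.

Lemma vabs_distC x y : vabs (x - y) = vabs (y - x).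
Proof. by rewrite -vabsN opprB. Qed.

Lemma vabsX x n : vabs (x ^+ n) = vabs x ^+ n.
Proof. by elim: n => [|n IHn]; rewrite ?expr0 ?vabs1// !exprS vabsM IHn. Qed.

Lemma vabsV x : vabs x^-1 = (vabs x)^-1.
Proof.
have [->|x0] := eqVneq x 0; first by rewrite invr0 vabs0 invr0.
have vx0 : vabs x != 0 by rewrite vabs_eq0.
by apply: (mulfI vx0); rewrite -vabsM !divff ?vabs1.
Qed.

Lemma vabs_prod (I : finType) (f : I -> K) :
  vabs (\prod_i f i) = \prod_i vabs (f i).
Proof. exact: (big_morph vabs (fun x y => vabsM x y) vabs1). Qed.

Lemma vabsD_le B x y : vabs x <= B -> vabs y <= B -> vabs (x + y) <= B.
Proof. by move=> xB yB; rewrite (le_trans (vabsD x y))// ge_max xB. Qed.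

Lemma vabsB_le B x y : vabs x <= B -> vabs y <= B -> vabs (x - y) <= B.
Proof. by move=> xB yB; rewrite vabsD_le ?vabsN. Qed.

Lemma vabsD_lt B x y : vabs x < B -> vabs y < B -> vabs (x + y) < B.
Proof. by move=> xB yB; rewrite (le_lt_trans (vabsD x y))// gt_max xB. Qed.

Lemma vabs_sum_le (I : Type) (s : seq I) (P : pred I) (f : I -> K) B :
  0 <= B -> (forall i, P i -> vabs (f i) <= B) ->
  vabs (\sum_(i <- s | P i) f i) <= B.
Proof.
move=> B0 fB; apply: (big_ind (fun x => vabs x <= B)) => //.
  by rewrite vabs0.
by move=> x y; exact: vabsD_le.
Qed.

Lemma vabs_sum_lt (I : Type) (s : seq I) (P : pred I) (f : I -> K) B :
  0 < B -> (forall i, P i -> vabs (f i) < B) ->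
  vabs (\sum_(i <- s | P i) f i) < B.
Proof.
move=> B0 fB; apply: (big_ind (fun x => vabs x < B)) => //.
  by rewrite vabs0.
by move=> x y; exact: vabsD_lt.
Qed.

Lemma vabs_nat_le1 n : vabs (n%:R : K) <= 1.
Proof.
elim: n => [|n IHn]; first by rewrite vabs0 ler01.
by rewrite -addn1 natrD vabsD_le ?vabs1.
Qed.

Lemma vabs_exprB_le x y n :
  vabs x <= 1 -> vabs y <= 1 -> vabs (x ^+ n - y ^+ n) <= vabs (x - y).
Proof.
move=> x1 y1; rewrite subrXX vabsM ler_piMr ?vabs_ge0// vabs_sum_le// => i _.
by rewrite vabsM !vabsX mulr_ile1 ?exprn_ge0 ?exprn_ile1 ?vabs_ge0.
Qed.

End UltrametricAbsoluteValue.

Section UltrametricLimits.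
Context {R : realType} {K : valuedFieldType R}.
Implicit Types (x y l : K).

Lemma vcvgP {T : Type} {F : set_system T} {FF : Filter F} (f : T -> K) l :
  f @ F --> l <-> forall e, 0 < e -> \forall t \near F, vabs (f t - l) < e.
Proof.
have ballE t e : ball l e (f t) = (vabs (f t - l) < e) :> Prop.
  by rewrite ballEmdist /= vabs_distC.
rewrite cvg_ballP; split=> fl e e0; have := fl e e0;
  by apply: filterS => t; rewrite ballE.
Qed.

Lemma vcvg_dominated {T : Type} {F : set_system T} {FF : Filter F}
    (f : T -> K) l (g : T -> R) :
  (\forall t \near F, vabs (f t - l) <= g t) -> g @ F --> (0 : R) ->
  f @ F --> l.
Proof.
move=> fg /cvgrPdist_lt g0; apply/vcvgP => e e0.
near=> t; apply: (@le_lt_trans _ _ (g t)); first by near: t.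
by rewrite (le_lt_trans (ler_norm _))// -normrN -sub0r; near: t; exact: g0.
Unshelve. all: by end_near. Qed.

Lemma vcvg_vabs {T : Type} {F : set_system T} {FF : Filter F} (f : T -> K) l :
  f @ F --> l -> (fun t => vabs (f t - l)) @ F --> (0 : R).
Proof.
move=> /vcvgP fl; apply/cvgrPdist_lt => e e0; near=> t.
by rewrite sub0r normrN ger0_norm ?vabs_ge0//; near: t; exact: fl.
Unshelve. all: by end_near. Qed.

Lemma vcvgD {T : Type} {F : set_system T} {FF : Filter F} (f g : T -> K) (l m : K) :
  f @ F --> l -> g @ F --> m -> (fun t => f t + g t) @ F --> l + m.
Proof.
move=> /vcvgP fl /vcvgP gm; apply/vcvgP => e e0; near=> t.
have -> : f t + g t - (l + m) = (f t - l) + (g t - m) by ring.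
by rewrite vabsD_lt//; near: t; [exact: fl | exact: gm].
Unshelve. all: by end_near. Qed.

Lemma vcvgM {T : Type} {F : set_system T} {FF : Filter F} (f g : T -> K) (l m : K) :
  f @ F --> l -> g @ F --> m -> (fun t => f t * g t) @ F --> l * m.
Proof.
move=> fl gm; apply: (@vcvg_dominated _ _ _ _ _ (fun t =>
  vabs (f t - l) * vabs (g t - m) + vabs (f t - l) * vabs m
    + vabs l * vabs (g t - m))).
  apply: nearW => t; rewrite -!vabsM.
  have -> : f t * g t - l * m =
    (f t - l) * (g t - m) + (f t - l) * m + l * (g t - m) by ring.
  have := vabs_ge0 ((f t - l) * (g t - m)).
  have := vabs_ge0 ((f t - l) * m); have := vabs_ge0 (l * (g t - m)).
  by move=> ? ? ?; apply: vabsD_le; [apply: vabsD_le|]; lra.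
rewrite [X in _ --> X](_ : _ = 0 * 0 + 0 * vabs m + vabs l * 0 :> R); last by ring.
have /(_ FF) f0 := vcvg_vabs fl; have /(_ FF) g0 := vcvg_vabs gm.
apply: cvgD; last exact: cvgMl_tmp.
by apply: cvgD; [exact: cvgM | exact: cvgMr_tmp].
Qed.

Lemma vcvg_sum {T I : Type} {F : set_system T} {FF : Filter F}
    (s : seq I) (f : I -> T -> K) (l : I -> K) :
  (forall i, f i @ F --> l i) ->
  (fun t => \sum_(i <- s) f i t) @ F --> \sum_(i <- s) l i.
Proof.
move=> fl; elim: s => [|i s IHs].
  rewrite big_nil; under eq_fun do rewrite big_nil; exact: cvg_cst.
rewrite big_cons; under eq_fun do rewrite big_cons; exact: vcvgD.
Qed.

Lemma vcvg_prod {T I : Type} {F : set_system T} {FF : Filter F}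
    (s : seq I) (f : I -> T -> K) (l : I -> K) :
  (forall i, f i @ F --> l i) ->
  (fun t => \prod_(i <- s) f i t) @ F --> \prod_(i <- s) l i.
Proof.
move=> fl; elim: s => [|i s IHs].
  rewrite big_nil; under eq_fun do rewrite big_nil; exact: cvg_cst.
rewrite big_cons; under eq_fun do rewrite big_cons; exact: vcvgM.
Qed.

Lemma vlimn_eq (f : nat -> K) l : f @ \oo --> l -> limn f = l.
Proof. exact/cvg_lim/metric_hausdorff. Qed.

Lemma vabs_limB_le (f g : nat -> K) (l m : K) B :
  f @ \oo --> l -> g @ \oo --> m ->
  (\forall n \near \oo, vabs (f n - g n) <= B) -> vabs (l - m) <= B.
Proof.
move=> /vcvgP fl /vcvgP gm fgB; apply/ler_addgt0Pr => e e0.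
near \oo => n.
have fnl : vabs (f n - l) < e by near: n; exact: fl.
have gnm : vabs (g n - m) < e by near: n; exact: gm.
have fgn : vabs (f n - g n) <= B by near: n.
have B0 := le_trans (vabs_ge0 _) fgn.
rewrite -[l - m](_ : (l - f n) + (f n - g n) + (g n - m) = _); last by ring.
apply: vabsD_le; last by rewrite (le_trans (ltW gnm))// lerDr.
apply: vabsD_le; last by rewrite (le_trans fgn)// lerDl ltW.
by rewrite vabs_distC (le_trans (ltW fnl))// lerDr.
Unshelve. all: by end_near. Qed.

(** In an ultrametric field a series converges as soon as its terms tend to
    zero: a block of terms is no larger than its largest term. *)
Lemma vseries_cvg (f : nat -> K) (g : nat -> R) :
  (forall F : set_system K, ProperFilter F -> cauchy F -> cvg F) ->
  (forall n, vabs (f n) <= g n) -> g @ \oo --> (0 : R) ->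
  cvgn (fun N => \sum_(n < N) f n).
Proof.
move=> complete fg g0; apply: complete; apply/cauchy_exP => e e0.
have [N _ gN] := (@cvgrPdist_lt _ _ _ _ _ g 0).1 g0 e e0.
exists (\sum_(n < N) f n); exists N => //= M /= NM.
rewrite ballEmdist /= /mdist /= /vdist vabs_distC -(subnKC NM).
rewrite big_split_ord /= addrAC subrr add0r.
apply: vabs_sum_lt => // i _; rewrite (le_lt_trans (fg _))//.
rewrite (le_lt_trans (ler_norm _))// -normrN -sub0r gN//=.
exact: leq_addr.
Qed.

End UltrametricLimits.

(** * Geometric sums and formal power series *)

Section GeometricSums.
Variable A : comUnitRingType.

Lemma expr_prod_ord (x : A) r : x ^+ r = \prod_(j < r) x.
Proof. by rewrite prodr_const card_ord. Qed.

Lemma sum_geometric (z : A) M : 1 - z \is a GRing.unit ->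
  \sum_(k < M) z ^+ k = (1 - z ^+ M) / (1 - z).
Proof.
move=> uz; apply: (mulIr uz); rewrite divrK// -[1 - z ^+ M]opprB subrX1.
by rewrite -mulNr opprB mulrC.
Qed.

(** Distributivity: a sum over a box of a product of one-variable functions is
    the product of the one-variable sums. *)
Lemma sum_ffun_geometric M r (z : 'I_r -> A) (v : A) :
  (forall j, 1 - z j * v \is a GRing.unit) ->
  \sum_(x : {ffun 'I_r -> 'I_M}) (\prod_j z j ^+ x j) * v ^+ (\sum_j x j)%N =
  \prod_j ((1 - (z j * v) ^+ M) / (1 - z j * v)).
Proof.
move=> uz; under [RHS]eq_bigr do rewrite -sum_geometric//.
rewrite bigA_distr_bigA; apply: eq_bigr => x _.
by rewrite -prodrXr -big_split; apply: eq_bigr => j _; rewrite exprMn.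
Qed.

End GeometricSums.

Section FormalPowerSeries.
Variable F : fieldType.
Implicit Types (f g : fps F) (c d : F).

Lemma fpsM_coef f g n : (f * g) n = \sum_(i < n.+1) f i * g (n - i)%N.
Proof. by []. Qed.

Lemma fps_ext f g : (forall n, f n = g n) -> f = g.
Proof. exact: funext. Qed.

Lemma fps_coefB f g n : (f - g) n = f n - g n.
Proof. by []. Qed.

Lemma fps_coef_sum (I : Type) (s : seq I) (h : I -> fps F) n :
  (\sum_(i <- s) h i) n = \sum_(i <- s) h i n.
Proof. exact: (big_morph (fun f : fps F => f n)). Qed.

Lemma fps_coef_constM c f n : (fps_const c * f) n = c * f n.
Proof.
rewrite fpsM_coef big_ord_recl big1 ?addr0 ?subn0// => i _.
by rewrite /fps_const mul0r.
Qed.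

Lemma fps_const1 : fps_const 1 = 1 :> fps F.
Proof. by []. Qed.

Lemma fps_constM c d : fps_const (c * d) = fps_const c * fps_const d.
Proof.
apply: fps_ext => n; rewrite fps_coef_constM /fps_const.
by case: ifP => //; rewrite mulr0.
Qed.

Lemma fps_constB c d : fps_const (c - d) = fps_const c - fps_const d.
Proof.
apply: fps_ext => n; rewrite fps_coefB /fps_const.
by case: ifP => //; rewrite subr0.
Qed.

Lemma fps_constX c n : fps_const (c ^+ n) = fps_const c ^+ n.
Proof. by elim: n => // n IHn; rewrite !exprS fps_constM IHn. Qed.

Lemma fps_unitE f : (f \is a GRing.unit) = (f 0%N != 0).
Proof. by []. Qed.

Lemma fps_exp0E c : fps_exp c 0 = 1.
Proof. by rewrite /fps_exp expr0 divr1. Qed.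

Lemma fps_exp_0 : fps_exp 0 = 1 :> fps F.
Proof.
apply: fps_ext => -[|n]; first exact: fps_exp0E.
by rewrite /fps_exp expr0n mul0r.
Qed.

Hypothesis fact_neq0 : forall n, n`!%:R != 0 :> F.

Lemma fps_expD c d :
  fps_exp (c + d) = fps_exp c * fps_exp d.
Proof.
apply/funext => n; rewrite fpsM_coef /fps_exp addrC exprDn mulr_suml.
apply: eq_bigr => i _; rewrite mulrACA -invfM -natrM.
have in' : (i <= n)%N by rewrite -ltnS.
have := fact_neq0 n; rewrite -(bin_fact in') natrM => /[dup].
rewrite mulf_eq0 negb_or => /andP[C0 _] _.
rewrite -mulr_natr [d ^+ _ * _]mulrC.
by rewrite invfM mulrA mulfK// [(i`! * _)%N]mulnC.
Qed.

Lemma fps_exp_sum r (c : 'I_r -> F) :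
  fps_exp (\sum_j c j) = \prod_j fps_exp (c j).
Proof. exact: (big_morph _ fps_expD fps_exp_0). Qed.

Lemma fps_expX c n : fps_exp (c * n%:R) = fps_exp c ^+ n.
Proof.
elim: n => [|n IHn]; first by rewrite mulr0 fps_exp_0.
by rewrite -natr1 mulrDr mulr1 fps_expD// IHn exprSr.
Qed.

End FormalPowerSeries.

Section CoefficientwiseLimits.
Context {R : realType} {K : valuedFieldType R}.

(** Convergence in the product topology of the coefficient sequences; the
    Cauchy product is continuous for it because each coefficient of a product
    involves finitely many coefficients of the factors. *)
Definition fps_cvg (f : nat -> fps K) (l : fps K) :=
  forall i, (fun N => f N i) @ \oo --> l i.

Lemma fps_cvg_cst (l : fps K) : fps_cvg (fun=> l) l.
Proof. by move=> i; exact: cvg_cst. Qed.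

Lemma fps_cvgM f g l m :
  fps_cvg f l -> fps_cvg g m -> fps_cvg (fun N => f N * g N) (l * m).
Proof.
move=> fl gm i; under eq_fun do rewrite fpsM_coef.
by rewrite fpsM_coef; apply: vcvg_sum => k; apply: vcvgM.
Qed.

Lemma fps_cvg_prod r (f : 'I_r -> nat -> fps K) (l : 'I_r -> fps K) :
  (forall j, fps_cvg (f j) (l j)) ->
  fps_cvg (fun N => \prod_j f j N) (\prod_j l j).
Proof.
move=> fl; elim: (index_enum _) => [|j s IHs].
  rewrite big_nil; under eq_fun do rewrite big_nil; exact: fps_cvg_cst.
by rewrite big_cons; under eq_fun do rewrite big_cons; exact: fps_cvgM.
Qed.

End CoefficientwiseLimits.

(** * The p-adic size of factorials *)

Section PadicSize.
Context {R : realType} {K : valuedFieldType R} (p : nat).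
Hypotheses (p_prime : prime p) (vabs_p : vabs (p%:R : K) = p%:R^-1).

Local Notation rho := (exp_radius R p).

Let p_gt0 : 0 < p%:R :> R.
Proof. by rewrite ltr0n prime_gt0. Qed.

Let p1_gt0 : (0 < p.-1)%N.
Proof. by case: p p_prime => [|[|]]. Qed.

(** Legendre's estimate with the bound [n - 1] instead of [n]; the improvement
    by one is what puts a spare factor [x] into the terms [x ^ n / n!]. *)
Lemma logn_fact_le n : (p.-1 * logn p n`! <= n.-1)%N.
Proof.
case: n => [|n]; first by rewrite logn1 muln0.
rewrite logn_fact//; set N := n.+1.
(* As long as [N %/ p ^ m] is positive, one more term of Legendre's sum costs at
   most [N %/ p ^ m - N %/ p ^ m.+1]; once it vanishes nothing is added. Keeping
   [maxn 1] in the invariant records that the last positive quotient, which is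
   at least 1, is never spent. *)
suff /(_ N) H : forall m,
    (p.-1 * (\sum_(1 <= k < m.+1) N %/ p ^ k) + maxn 1 (N %/ p ^ m) <= N)%N.
  by move: H; rewrite /N; lia.
elim=> [|m IHm]; first by rewrite big_geq// muln0 add0n expn0 divn1 /N; lia.
rewrite big_nat_recr//= expnSr divnMA.
have := leq_trunc_div (N %/ p ^ m) p.
set A := (\sum_(_ <= _ < _) _)%N in IHm *; move: IHm.
by move: (prime_gt0 p_prime); nia.
Qed.

(** In a Bezout relation [a p - b m = 1] the term [a p] is smaller than 1, so
    [b m], and with it [m], cannot be. *)
Lemma vabs_coprime m : coprime p m -> vabs (m%:R : K) = 1.
Proof.
move=> /(coprimeP _ (prime_gt0 p_prime)) [[a b] /= ab].
apply/eqP; rewrite eq_le vabs_nat_le1 leNgt; apply/negP => m1.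
suff : vabs (1 : K) < 1 by rewrite vabs1 ltxx.
have -> : 1 = a%:R * p%:R - b%:R * m%:R :> K.
  by rewrite -!natrM -natrB ?ab//; lia.
apply: vabsD_lt; rewrite ?vabsN vabsM.
  rewrite (le_lt_trans (ler_piMl _ (vabs_nat_le1 a)))// ?vabs_ge0//.
  by rewrite vabs_p invf_lt1// ltr1n prime_gt1.
by rewrite (le_lt_trans (ler_piMl _ (vabs_nat_le1 b)))// ?vabs_ge0.
Qed.

Lemma vabs_natE n : (0 < n)%N -> vabs (n%:R : K) = p%:R^-1 ^+ logn p n.
Proof.
move=> n0; have [m pm {1}->] := pfactor_coprime p_prime n0.
by rewrite natrM natrX vabsM vabsX vabs_coprime// mul1r vabs_p.
Qed.

Lemma exp_radius_gt0 : 0 < rho.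
Proof. exact: powR_gt0. Qed.

Lemma exp_radiusX : rho ^+ p.-1 = p%:R^-1.
Proof.
rewrite -powR_mulrn ?powR_ge0// -powRrM mulNr mulVf ?powR_inv1// ?ltW//.
by rewrite pnatr_eq0 -lt0n.
Qed.

Lemma exp_radius_lt1 : rho < 1.
Proof.
rewrite -(@ltr_pXn2r _ p.-1)// ?nnegrE ?(ltW exp_radius_gt0)// expr1n.
by rewrite exp_radiusX invf_lt1// ltr1n prime_gt1.
Qed.

(** Legendre's estimate read through [rho ^ (p - 1) = |p|]. *)
Lemma vabs_fact_ge n : rho ^+ n.-1 <= vabs (n`!%:R : K).
Proof.
rewrite vabs_natE ?fact_gt0// -exp_radiusX -exprM.
by rewrite ler_wiXn2l ?logn_fact_le// ltW// (exp_radius_gt0, exp_radius_lt1).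
Qed.

(** Since [n] divides [n!], the terms of the logarithm obey the same bound as
    those of the exponential. *)
Lemma vabs_nat_ge n : (0 < n)%N -> rho ^+ n.-1 <= vabs (n%:R : K).
Proof.
case: n => // n _; rewrite (le_trans (vabs_fact_ge _))// factS natrM vabsM.
by rewrite ler_piMr ?vabs_ge0 ?vabs_nat_le1.
Qed.

Lemma fact_neq0 n : n`!%:R != 0 :> K.
Proof.
rewrite -vabs_eq0 gt_eqF// (lt_le_trans _ (vabs_fact_ge n))//.
by rewrite exprn_gt0// exp_radius_gt0.
Qed.

(** Meant for [c = (n + 1)!] and [c = n + 1], the denominators of the
    exponential and of the logarithm. *)
Lemma vabs_term_le x c n :
  rho ^+ n <= vabs c -> vabs (x ^+ n.+1 / c : K) <= vabs x * (vabs x / rho) ^+ n.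
Proof.
move=> cn; have rn0 : 0 < rho ^+ n by rewrite exprn_gt0// exp_radius_gt0.
rewrite vabsM vabsV vabsX exprS -mulrA expr_div_n.
rewrite ler_wpM2l ?vabs_ge0// ler_wpM2l ?exprn_ge0 ?vabs_ge0//.
by rewrite lef_pV2// posrE (lt_le_trans rn0).
Qed.

Lemma expn_cvg0 : (fun N => (p ^ N)%:R) @ \oo --> (0 : K).
Proof.
apply: (@vcvg_dominated _ _ _ _ _ _ _ (fun N => p%:R^-1 ^+ N)).
  by apply: nearW => N; rewrite subr0 natrX vabsX vabs_p.
apply: cvg_expr; rewrite ger0_norm ?invr_ge0//.
by rewrite invf_lt1 ?ltr1n ?ltr0n ?prime_gt1 ?prime_gt0.
Qed.

End PadicSize.

(** * The p-adic exponential and logarithm *)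

Section PadicExpLog.
Context {R : realType} {K : valuedFieldType R} (p : nat).
Hypotheses (p_prime : prime p) (vabs_p : vabs (p%:R : K) = p%:R^-1).
Hypothesis complete :
  forall F : set_system K, ProperFilter F -> cauchy F -> cvg F.
Implicit Types q x y : K.

Local Notation rho := (exp_radius R p).
Let rho_gt0 : 0 < rho := exp_radius_gt0 p_prime.
Let rho_lt1 : rho < 1 := exp_radius_lt1 p_prime.

Let ratio_lt1 x : vabs x < rho -> vabs x / rho < 1.
Proof. by move=> xr; rewrite ltr_pdivrMr// mul1r. Qed.

Let ratio_ge0 x : 0 <= vabs x / rho.
Proof. by rewrite divr_ge0 ?vabs_ge0 ?ltW. Qed.

Let ratio_cvg0 x : vabs x < rho -> (fun n => (vabs x / rho) ^+ n) @ \oo --> (0 : R).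
Proof. by move=> xr; apply: cvg_expr; rewrite ger0_norm ?ratio_lt1. Qed.

Let vabs_le_ratio x : vabs x <= vabs x / rho.
Proof. by rewrite ler_pdivlMr// ler_piMr ?vabs_ge0// ltW. Qed.

Lemma fps_exp_le x n : vabs (fps_exp x n) <= (vabs x / rho) ^+ n.
Proof.
case: n => [|n]; first by rewrite /fps_exp !expr0 divr1 vabs1.
rewrite (le_trans (vabs_term_le p_prime _ (vabs_fact_ge p_prime vabs_p n.+1)))//.
by rewrite exprS ler_wpM2r// exprn_ge0.
Qed.

(** The [n]-th coefficient [fps_exp x n] of the formal series [exp (x t)] is also
    the [n]-th term of the convergent series of [exp x]. *)
Lemma padic_exp_cvg x : vabs x < rho ->
  (fun N => \sum_(n < N) fps_exp x n) @ \oo --> padic_exp x.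
Proof.
by move=> xr; exact: (vseries_cvg complete (fps_exp_le x) (ratio_cvg0 xr)).
Qed.

(** Every term of degree at least 2 is at most [|x| ^ 2 / rho], and in an
    ultrametric field so is their sum. *)
Lemma padic_exp_linear_le x : vabs x < rho ->
  vabs (padic_exp x - 1 - x) <= vabs x ^+ 2 / rho.
Proof.
move=> xr; rewrite -addrA -opprD.
apply: (vabs_limB_le (padic_exp_cvg xr) (cvg_cst _)).
exists 2%N => //= -[|[|N]]// _.
rewrite !big_ord_recl /= [fps_exp x 0]/fps_exp [fps_exp x (bump 0 0)]/fps_exp.
rewrite !divr1 expr0 expr1 addrA [1 + x + _]addrC addrK.
apply: vabs_sum_le => [|n _]; first by rewrite divr_ge0 ?exprn_ge0 ?vabs_ge0 ?ltW.
have := vabs_term_le p_prime x (vabs_fact_ge p_prime vabs_p n.+2).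
move=> /le_trans; apply; rewrite expr2 -mulrA ler_wpM2l ?vabs_ge0// exprS.
by rewrite ler_piMr// exprn_ile1// ltW// ratio_lt1.
Qed.

Lemma padic_exp1_le x : vabs x < rho -> vabs (padic_exp x - 1) <= vabs x.
Proof.
move=> xr; rewrite -[_ - 1](subrK x); apply: vabsD_le => //.
rewrite (le_trans (padic_exp_linear_le xr))// expr2 -mulrA ler_piMr ?vabs_ge0//.
by rewrite ltW// ratio_lt1.
Qed.

Lemma padic_exp0 : padic_exp (0 : K) = 1.
Proof.
apply/eqP; rewrite -subr_eq0 -vabs_eq0 eq_le vabs_ge0 andbT.
by rewrite (le_trans (padic_exp1_le _))// vabs0.
Qed.

(** The partial sums of two exponential series are the values at 1 of two
    polynomials whose product agrees up to degree [N] with the series of the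
    sum; the coefficients beyond [N] are geometrically small. *)
Lemma padic_expD x y : vabs x < rho -> vabs y < rho ->
  padic_exp (x + y) = padic_exp x * padic_exp y.
Proof.
move=> xr yr; pose S (z : K) N := \sum_(n < N) fps_exp z n.
have xyr : vabs (x + y) < rho by apply: vabsD_lt.
suff diff0 : (fun N => S x N * S y N - S (x + y) N) @ \oo --> (0 : K).
  have SE : (fun N => S x N * S y N - S (x + y) N + S (x + y) N) @ \oo
      --> 0 + padic_exp (x + y) by apply: vcvgD => //; exact: padic_exp_cvg.
  have SM : (fun N => S x N * S y N) @ \oo --> padic_exp x * padic_exp y.
    by apply: vcvgM; exact: padic_exp_cvg.
  rewrite -(vlimn_eq SM) -[LHS]add0r -(vlimn_eq SE); congr (limn _).
  by apply/funext => N; rewrite subrK.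
pose M := Num.max (vabs x) (vabs y) / rho.
have M0 : 0 <= M by rewrite divr_ge0 ?le_max ?vabs_ge0 ?ltW.
have M1 : M < 1 by rewrite ltr_pdivrMr// mul1r gt_max xr.
have xM n : vabs (fps_exp x n) <= M ^+ n.
  rewrite (le_trans (fps_exp_le x n))// lerXn2r// ?nnegrE//.
  by apply: ler_wpM2r; [rewrite invr_ge0 ltW | rewrite le_max lexx].
have yM n : vabs (fps_exp y n) <= M ^+ n.
  rewrite (le_trans (fps_exp_le y n))// lerXn2r// ?nnegrE//.
  by apply: ler_wpM2r; [rewrite invr_ge0 ltW | rewrite le_max lexx orbT].
apply: (@vcvg_dominated _ _ _ _ _ _ _ (fun N => M ^+ N)); last first.
  by apply: cvg_expr; rewrite ger0_norm.
apply: nearW => N; rewrite subr0.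
pose P z : {poly K} := \poly_(i < N) fps_exp z i.
have PE z : S z N = (P z).[1].
  rewrite (@horner_coef_wide _ N) ?size_poly//; apply: eq_bigr => i _.
  by rewrite coef_poly ltn_ord expr1n mulr1.
have PM n : vabs (P x * P y)`_n <= M ^+ n.
  rewrite coefM; apply: vabs_sum_le => [|i _]; first exact: exprn_ge0.
  have in' : (i <= n)%N by rewrite -ltnS.
  rewrite !coef_poly; case: ifP => _; last by rewrite mul0r vabs0 exprn_ge0.
  case: ifP => _; last by rewrite mulr0 vabs0 exprn_ge0.
  by rewrite vabsM -[in X in _ <= X](subnKC in') exprD ler_pM ?vabs_ge0.
have PD n : (n < N)%N -> (P x * P y)`_n = fps_exp (x + y) n.
  move=> nN; rewrite (fps_expD (fact_neq0 p_prime vabs_p)) fpsM_coef coefM.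
  apply: eq_bigr => i _; rewrite !coef_poly (leq_ltn_trans _ nN) ?leq_ord//.
  by rewrite (leq_ltn_trans (leq_subr _ _)).
rewrite !PE -hornerM (@horner_coef_wide _ (N + N)); last first.
  by rewrite (leq_trans (size_polyMleq _ _))// (leq_trans (leq_pred _))// leq_add ?size_poly.
rewrite big_split_ord /= -PE /S addrAC -sumrB big1 => [|i _].
  rewrite add0r; apply: vabs_sum_le => [|i _]; first exact: exprn_ge0.
  by rewrite expr1n mulr1 (le_trans (PM _))// exprD ler_piMr ?exprn_ge0// exprn_ile1// ltW.
by rewrite expr1n mulr1 PD ?subrr.
Qed.

Lemma padic_exp_natM n x : vabs x < rho -> padic_exp (n%:R * x) = padic_exp x ^+ n.
Proof.
move=> xr; elim: n => [|n IHn]; first by rewrite mul0r padic_exp0.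
rewrite -natr1 mulrDl mul1r padic_expD ?IHn ?exprSr//.
by rewrite vabsM (le_lt_trans _ xr)// ler_piMl ?vabs_ge0// vabs_nat_le1.
Qed.

(** The terms of degree at least 2 in [q - 1] are bounded exactly as for the
    exponential. *)
Lemma padic_log_linear_le q : vabs (1 - q) < rho ->
  vabs (padic_log q - (q - 1)) <= vabs (1 - q) ^+ 2 / rho.
Proof.
rewrite [vabs (1 - q)]vabs_distC => qr.
pose t n : K := (-1) ^+ n * (q - 1) ^+ n.+1 / n.+1%:R.
have tle n : vabs (t n) <= vabs (q - 1) * (vabs (q - 1) / rho) ^+ n.
  rewrite /t -mulrA vabsM vabsX vabsN vabs1 expr1n mul1r.
  exact: (vabs_term_le p_prime _ (vabs_nat_ge p_prime vabs_p (ltn0Sn n))).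
have t0 : (fun n => vabs (q - 1) * (vabs (q - 1) / rho) ^+ n) @ \oo --> (0 : R).
  by apply: cvg_geometric; rewrite ger0_norm ?ratio_lt1.
have tcvg : (fun N => \sum_(n < N) t n) @ \oo --> padic_log q.
  exact: (vseries_cvg complete tle t0).
apply: (vabs_limB_le tcvg (cvg_cst _)).
exists 1%N => //= -[|N]// _.
rewrite big_ord_recl /= {1}/t expr0 mul1r expr1 divr1 addrAC subrr add0r.
apply: vabs_sum_le => [|n _]; first by rewrite divr_ge0 ?exprn_ge0 ?vabs_ge0 ?ltW.
rewrite (le_trans (tle _))// expr2 -mulrA ler_wpM2l ?vabs_ge0// exprS.
by rewrite ler_piMr// exprn_ile1// ltW// ratio_lt1.
Qed.

Lemma padic_log_le q : vabs (1 - q) < rho -> vabs (padic_log q) <= vabs (1 - q).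
Proof.
move=> qr; rewrite -[padic_log q](subrK (q - 1)).
apply: vabsD_le; last by rewrite vabs_distC.
rewrite (le_trans (padic_log_linear_le qr))// expr2 -mulrA ler_piMr ?vabs_ge0//.
by rewrite ltW// ratio_lt1.
Qed.

End PadicExpLog.

(** * Riemann sums of the Euler measure *)

Section EulerMeasure.
Context {R : realType} {K : valuedFieldType R} (p : nat).
Hypotheses (p_prime : prime p) (vabs_p : vabs (p%:R : K) = p%:R^-1).
Variables (u : K) (u_far : forall f : nat, (0 < f)%N -> 1 <= vabs (1 - u ^+ f)).

Let pX_gt0 N : (0 < p ^ N)%N.
Proof. by rewrite expn_gt0 prime_gt0. Qed.

Lemma one_sub_expr_neq0 M : (0 < M)%N -> 1 - u ^+ M != 0.
Proof. by move=> /u_far uM; rewrite -vabs_eq0 gt_eqF// (lt_le_trans ltr01). Qed.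

Lemma one_sub_neq0 : 1 - u != 0.
Proof. by rewrite -[u]expr1 one_sub_expr_neq0. Qed.

(** If [|u| <= 1], the left side is at most 1, which is the lower bound assumed
    for the right side; if [|u| > 1], the worst case is [k = M], and
    [u ^ M = 1 - (1 - u ^ M)] is a difference of two elements no larger than
    [1 - u ^ M]. *)
Lemma vabs_expr_le k M : (k <= M)%N -> (0 < M)%N ->
  vabs (u ^+ k) <= vabs (1 - u ^+ M).
Proof.
move=> kM M0; have uM := u_far M0.
have [u1|/ltW u1] := leP (vabs u) 1.
  by rewrite (le_trans _ uM)// vabsX exprn_ile1// vabs_ge0.
rewrite vabsX (le_trans (ler_weXn2l u1 kM))// -vabsX.
have := vabsB_le (_ : vabs 1 <= _) (lexx (vabs (1 - u ^+ M))).
by rewrite subKr vabs1; apply.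
Qed.

(** The weight is [(u ^ k - u ^ k.+1) / (1 - u ^ M)], with both exponents at
    most [M]. *)
Lemma mu_weight_le1 N (k : 'I_(p ^ N)) :
  vabs ((nat_bracket (p ^ N) u)^-1 * u ^+ k) <= 1.
Proof.
have M0 := pX_gt0 N.
rewrite /nat_bracket invf_div mulrC mulrA vabsM vabsV ler_pdivrMr; last first.
  by rewrite (lt_le_trans ltr01)// u_far.
rewrite mul1r mulrBr mulr1 -exprSr.
by apply: vabsB_le; apply: vabs_expr_le => //; exact: ltnW.
Qed.

(** [mu_u] has total variation at most one, so that approximations of the
    integrand are inherited by the Riemann sums without loss. *)
Lemma mu_sumB_le r (g h : ('I_r -> K) -> K) N B : 0 <= B ->
  (forall x : {ffun 'I_r -> 'I_(p ^ N)},
     vabs (g (fun j => (x j)%:R) - h (fun j => (x j)%:R)) <= B) ->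
  vabs (mu_sum p u g N - mu_sum p u h N) <= B.
Proof.
move=> B0 ghB; rewrite /mu_sum -mulrBr -sumrB mulr_sumr.
apply: vabs_sum_le => // x _; rewrite -mulrBl mulrCA vabsM.
rewrite (le_trans _ (ghB x))// ler_piMr ?vabs_ge0//.
rewrite -exprVn -prodrXr expr_prod_ord -big_split vabs_prod.
by rewrite prodr_ile1// => j _; rewrite vabs_ge0 mu_weight_le1.
Qed.

(** As [|u| <= |1 - u|], perturbing [u] to [z u] changes [1 - u] by less than
    its own absolute value. *)
Lemma one_sub_mul_neq0 z : vabs (1 - z) < 1 -> 1 - z * u != 0.
Proof.
move=> z1; apply/eqP => /subr0_eq zu.
have uE : (1 - z) * u = - (1 - u) by rewrite mulrBl mul1r -zu opprB.
have u0 : 0 < vabs u.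
  rewrite lt_neqAle vabs_ge0 andbT eq_sym vabs_eq0; apply/eqP => u0.
  by move/eqP: zu; rewrite u0 mulr0 oner_eq0.
have : vabs (1 - u) < vabs u by rewrite -vabsN -uE vabsM gtr_pMl.
rewrite ltNge; case/negP.
by have := @vabs_expr_le 1 1; rewrite expr1; exact.
Qed.

Lemma mu_sum_geometric r m (c : 'I_m -> K) (z : 'I_m -> 'I_r -> K) g N :
  (forall l j, 1 - z l j * u != 0) ->
  (forall x : {ffun 'I_r -> 'I_(p ^ N)},
     g (fun j => (x j)%:R) = \sum_l c l * \prod_j z l j ^+ x j) ->
  mu_sum p u g N =
  \sum_l c l * \prod_j ((1 - u) / (1 - z l j * u) *
               ((1 - (z l j * u) ^+ (p ^ N)) / (1 - u ^+ (p ^ N)))).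
Proof.
move=> uz gE; rewrite /mu_sum.
rewrite [X in _ * X](eq_bigr (fun x : {ffun 'I_r -> 'I_(p ^ N)} =>
    \sum_l c l * ((\prod_j z l j ^+ x j) * u ^+ (\sum_j x j)%N))); last first.
  move=> x _; under [RHS]eq_bigr do rewrite mulrA.
  by rewrite -mulr_suml; congr (_ * _); exact: gE.
rewrite exchange_big mulr_sumr; apply: eq_bigr => l _.
rewrite -mulr_sumr sum_ffun_geometric => [|j]; last by rewrite unitfE.
rewrite mulrCA; congr (_ * _).
rewrite -exprVn expr_prod_ord -big_split; apply: eq_bigr => j _.
by rewrite /nat_bracket invf_div /=; ring.
Qed.

(** The quotient differs from 1 by [1 - z ^ M] times
    [u ^ M / (1 - u ^ M)], a factor of absolute value at most 1. *)
Lemma geometric_ratio_cvg z : (fun N => z ^+ (p ^ N)) @ \oo --> (1 : K) ->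
  (fun N => (1 - (z * u) ^+ (p ^ N)) / (1 - u ^+ (p ^ N))) @ \oo --> (1 : K).
Proof.
move=> /vcvg_vabs z1; apply: vcvg_dominated z1; apply: nearW => N.
have uN := one_sub_expr_neq0 (pX_gt0 N).
have -> : (1 - (z * u) ^+ (p ^ N)) / (1 - u ^+ (p ^ N)) - 1 =
    - (z ^+ (p ^ N) - 1) * (u ^+ (p ^ N) / (1 - u ^+ (p ^ N))).
  by rewrite exprMn; field.
rewrite vabsM vabsN ler_piMr ?vabs_ge0// vabsM vabsV ler_pdivrMr; last first.
  by rewrite (lt_le_trans ltr01)// u_far.
by rewrite mul1r vabs_expr_le.
Qed.

(** The main computation of an iterated integral: the Riemann sums of a
    combination of exponentials factor into geometric sums. *)
Lemma mu_sum_exponential_cvg r m (c : 'I_m -> K) (z : 'I_m -> 'I_r -> K) g :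
  (forall l j, vabs (1 - z l j) < 1) ->
  (forall l j, (fun N => z l j ^+ (p ^ N)) @ \oo --> (1 : K)) ->
  (forall x : 'I_r -> nat,
     g (fun j => (x j)%:R) = \sum_l c l * \prod_j z l j ^+ x j) ->
  mu_sum p u g @ \oo --> \sum_l c l * \prod_j ((1 - u) / (1 - z l j * u)).
Proof.
move=> zs z1 gE.
under eq_cvg => N do rewrite (mu_sum_geometric (N := N)
  (fun l j => one_sub_mul_neq0 (zs l j)) (fun x => gE (fun j => nat_of_ord (x j)))).
apply: vcvg_sum => l; apply: vcvgM; first exact: cvg_cst.
apply: vcvg_prod => j; rewrite -[X in _ --> X]mulr1.
by apply: vcvgM; [exact: cvg_cst | exact: geometric_ratio_cvg].
Qed.

Lemma one_sub_fps_exp_unit c : 1 - fps_exp c * fps_const u \is a GRing.unit.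
Proof.
rewrite fps_unitE fps_coefB [_ * fps_const u]mulrC fps_coef_constM fps_exp0E mulr1.
exact: one_sub_neq0.
Qed.

(** Passing to formal power series in [t] turns the powers of [w + a . x] into
    the exponentials [exp ((w + a . x) t)], whose sums are geometric. *)
Lemma mu_sum_power r n w (a : 'I_r -> K) N :
  mu_sum p u (fun x => (w + \sum_j a j * x j) ^+ n) N =
  n`!%:R * (fps_exp w * \prod_j (fps_const (1 - u) / (1 - fps_exp (a j) * fps_const u) *
     (fps_const (1 - u ^+ (p ^ N))^-1 *
       (1 - (fps_exp (a j) * fps_const u) ^+ (p ^ N))))) n.
Proof.
have fact0 := fact_neq0 p_prime vabs_p.
have uz j := one_sub_fps_exp_unit (a j).
set beta : K := (nat_bracket (p ^ N) u)^-1.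
have -> : \prod_j (fps_const (1 - u) / (1 - fps_exp (a j) * fps_const u) *
     (fps_const (1 - u ^+ (p ^ N))^-1 *
       (1 - (fps_exp (a j) * fps_const u) ^+ (p ^ N)))) =
   fps_const (beta ^+ r) * \sum_(x : {ffun 'I_r -> 'I_(p ^ N)})
     (\prod_j fps_exp (a j) ^+ x j) * fps_const u ^+ (\sum_j x j)%N.
  rewrite sum_ffun_geometric// fps_constX [fps_const beta ^+ r]expr_prod_ord -big_split.
  apply: eq_bigr => j _; rewrite /beta /nat_bracket invf_div fps_constM /=.
  by rewrite mulrACA [_^-1 * _]mulrC; congr (_ * _).
rewrite mulrCA [fps_exp w * _]mulr_sumr fps_coef_constM fps_coef_sum /mu_sum mulrCA -exprVn.
congr (_ * _); rewrite mulr_sumr; apply: eq_bigr => x _.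
rewrite -fps_constX mulrA [_ * fps_const _]mulrC fps_coef_constM mulrCA mulrC.
congr (_ * _); under eq_bigr do rewrite -fps_expX//.
by rewrite -fps_exp_sum// -fps_expD// /fps_exp mulrC divfK.
Qed.

(** The analogue of [geometric_ratio_cvg] for the series [z = exp (c t)]: here
    [z ^ M = exp (M c t)], whose coefficient of positive degree [i] contains the
    null sequence [M ^ i]. *)
Lemma geometric_ratio_fps_cvg c :
  fps_cvg (fun N => fps_const (1 - u ^+ (p ^ N))^-1 *
                    (1 - (fps_exp c * fps_const u) ^+ (p ^ N))) 1.
Proof.
have fact0 := fact_neq0 p_prime vabs_p.
move=> i; set f := (X in X @ _).
have fE N : f N = (i == 0%N)%:R + u ^+ (p ^ N) / (1 - u ^+ (p ^ N)) *
    ((i == 0%N)%:R - (p ^ N)%:R ^+ i * fps_exp c i).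
  have uN := one_sub_expr_neq0 (pX_gt0 N).
  rewrite /f fps_coef_constM fps_coefB exprMn -fps_expX// -fps_constX.
  rewrite [_ * fps_const _]mulrC fps_coef_constM /fps_exp exprMn.
  have -> : (1 : fps K) i = (i == 0%N)%:R by rewrite -fps_const1 /fps_const; case: eqP.
  by field; rewrite uN fact0.
have [i0|i0] := posnP i.
  rewrite (_ : f = fun=> 1); first by rewrite i0; exact: cvg_cst.
  apply/funext => N; rewrite fE i0 eqxx expr0 mul1r fps_exp0E subrr.
  by rewrite mulr0 addr0.
have -> : (1 : fps K) i = 0 by rewrite -fps_const1 /fps_const gtn_eqF.
have pc0 : (fun N => vabs ((p ^ N)%:R * fps_exp c i)) @ \oo --> (0 : R).
  have := vcvg_vabs (vcvgM (expn_cvg0 p_prime vabs_p) (cvg_cst (fps_exp c i))).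
  by rewrite mul0r; under eq_fun do rewrite subr0; exact.
apply: vcvg_dominated pc0; apply: nearW => N.
rewrite fE gtn_eqF// add0r sub0r subr0 vabsM vabsN.
rewrite (@le_trans _ _ (vabs ((p ^ N)%:R ^+ i * fps_exp c i)))//.
  rewrite ler_piMl ?vabs_ge0// vabsM vabsV ler_pdivrMr; last first.
    by rewrite (lt_le_trans ltr01)// u_far.
  by rewrite mul1r vabs_expr_le.
rewrite !(vabsM _ (fps_exp c i)); apply: ler_wpM2r; first exact: vabs_ge0.
by rewrite vabsX ler_iXnr ?vabs_ge0 ?vabs_nat_le1.
Qed.

(** Multiplying numerator and denominator by [- u^-1] turns
    [(1 - u) / (1 - u e)] into [(1 - u^-1) / (e - u^-1)]. *)
Lemma EulerBarnesE r n w (a : 'I_r -> K) : u != 0 ->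
  EulerBarnes n w u^-1 a =
  n`!%:R * (fps_exp w *
    \prod_j (fps_const (1 - u) / (1 - fps_exp (a j) * fps_const u))) n.
Proof.
move=> u0; have uz j := one_sub_fps_exp_unit (a j).
have vz j : fps_exp (a j) - fps_const u^-1 \is a GRing.unit.
  rewrite fps_unitE fps_coefB fps_exp0E /fps_const eqxx -(mulVf u0).
  by rewrite -{2}[u^-1]mulr1 -mulrBr mulf_neq0 ?invr_eq0 // -oppr_eq0 opprB one_sub_neq0.
rewrite /EulerBarnes /fps_coef.
suff -> : fps_const ((1 - u^-1) ^+ r) / \prod_j (fps_exp (a j) - fps_const u^-1) =
    \prod_j (fps_const (1 - u) / (1 - fps_exp (a j) * fps_const u))
  by rewrite [_ * fps_exp w]mulrC.
have uV : fps_const u^-1 * fps_const u = 1 :> fps K.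
  by rewrite -fps_constM mulVf.
rewrite fps_constX [fps_const (1 - u^-1) ^+ r]expr_prod_ord.
apply: (canLR (mulrK _)); first by rewrite unitr_prod.
rewrite -big_split /=; apply: eq_bigr => j _.
rewrite !fps_constB fps_const1; move: (fps_exp _) (fps_const u^-1) (fps_const u) uV (uz j).
move=> e v' u' uV' uze.
apply: (mulIr uze); rewrite [RHS]mulrAC divrK//.
by ring: uV'.
Qed.

Lemma mu_sum_power_cvg r n w (a : 'I_r -> K) : u != 0 ->
  mu_sum p u (fun x => (w + \sum_j a j * x j) ^+ n) @ \oo -->
  EulerBarnes n w u^-1 a.
Proof.
move=> u0; rewrite EulerBarnesE//; under eq_cvg do rewrite mu_sum_power.
apply: vcvgM; first exact: cvg_cst.
apply: fps_cvgM; first exact: fps_cvg_cst.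
apply: fps_cvg_prod => j; rewrite -[X in fps_cvg _ X]mulr1.
by apply: fps_cvgM; [exact: fps_cvg_cst | exact: geometric_ratio_fps_cvg].
Qed.

End EulerMeasure.

(** * The q-bracket and the q-analogue of the Euler-Barnes polynomials *)

Section QPowers.
Context {R : realType} {K : valuedFieldType R} (p : nat).
Hypotheses (p_prime : prime p) (vabs_p : vabs (p%:R : K) = p%:R^-1).
Hypothesis complete :
  forall F : set_system K, ProperFilter F -> cauchy F -> cvg F.
Local Notation rho := (exp_radius R p).
Variables (q : K) (q_near1 : vabs (1 - q) < rho).
Implicit Types x y : K.

Lemma vabs_log_mul_le x : vabs x <= 1 -> vabs (x * padic_log q) <= vabs (1 - q).
Proof.
move=> x1; rewrite vabsM.
rewrite (le_trans (ler_piMl (vabs_ge0 _) x1))//.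
exact: padic_log_le p_prime vabs_p complete _ q_near1.
Qed.

Lemma vabs_log_mul_lt x : vabs x <= 1 -> vabs (x * padic_log q) < rho.
Proof. by move=> x1; rewrite (le_lt_trans (vabs_log_mul_le x1)). Qed.

Lemma padic_powD x y : vabs x <= 1 -> vabs y <= 1 ->
  padic_pow q (x + y) = padic_pow q x * padic_pow q y.
Proof.
by move=> x1 y1; rewrite /padic_pow mulrDl (padic_expD p_prime vabs_p complete) ?vabs_log_mul_lt.
Qed.

Lemma padic_pow0 : padic_pow q 0 = 1.
Proof. by rewrite /padic_pow mul0r; exact: (padic_exp0 p_prime vabs_p complete). Qed.

Lemma padic_pow_natM n x : vabs x <= 1 ->
  padic_pow q (n%:R * x) = padic_pow q x ^+ n.
Proof.
move=> x1; rewrite /padic_pow -mulrA.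
by rewrite (padic_exp_natM p_prime vabs_p complete)// vabs_log_mul_lt.
Qed.

Lemma padic_pow_sum (I : Type) (s : seq I) (x : I -> K) :
  (forall i, vabs (x i) <= 1) ->
  padic_pow q (\sum_(i <- s) x i) = \prod_(i <- s) padic_pow q (x i).
Proof.
move=> x1; elim: s => [|i s IHs]; first by rewrite !big_nil padic_pow0.
by rewrite !big_cons padic_powD ?IHs//; apply: vabs_sum_le.
Qed.

Lemma padic_pow1_le x : vabs x <= 1 -> vabs (1 - padic_pow q x) <= vabs (1 - q).
Proof.
move=> x1; rewrite vabs_distC (le_trans _ (vabs_log_mul_le x1))//.
by apply: (padic_exp1_le p_prime vabs_p complete); exact: vabs_log_mul_lt.
Qed.

(** [(q ^ x) ^ M] is the exponential of [M x log q], and [M = p ^ N] tends to 0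
    in [K]. *)
Lemma padic_pow_expX_cvg x : vabs x <= 1 ->
  (fun N => padic_pow q x ^+ (p ^ N)) @ \oo --> (1 : K).
Proof.
move=> x1; have z0 : (fun N => vabs ((p ^ N)%:R * padic_log q)) @ \oo --> (0 : R).
  have := vcvg_vabs (vcvgM (expn_cvg0 p_prime vabs_p) (cvg_cst (padic_log q))).
  by rewrite mul0r; under eq_fun do rewrite subr0; exact.
apply: vcvg_dominated z0; apply: nearW => N; rewrite -padic_pow_natM//.
have px1 : vabs ((p ^ N)%:R * x) <= 1.
  by rewrite vabsM mulr_ile1 ?vabs_ge0 ?vabs_nat_le1.
rewrite (le_trans (padic_exp1_le p_prime vabs_p complete (vabs_log_mul_lt px1)))//.
by rewrite mulrAC vabsM ler_piMr ?vabs_ge0.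
Qed.

(** [q ^ x - 1 = x log q = x (q - 1)] up to an error of order two in [1 - q], so
    the bracket [[x : q]] is within order one of [x], uniformly in [x]. *)
Lemma qbracket_le x : q != 1 -> vabs x <= 1 ->
  vabs (qbracket x q - x) <= vabs (1 - q) / rho.
Proof.
move=> q1 x1; have rho0 := exp_radius_gt0 (R := R) p_prime.
have q1' : 1 - q != 0 by rewrite subr_eq0 eq_sym.
have q0 : 0 < vabs (1 - q) by rewrite lt_neqAle vabs_ge0 eq_sym vabs_eq0 q1'.
have -> : qbracket x q - x =
  - (padic_pow q x - 1 - x * padic_log q + x * (padic_log q - (q - 1))) / (1 - q).
  by rewrite /qbracket; field.
rewrite vabsM vabsN vabsV ler_pdivrMr// -mulrAC -expr2.
apply: vabsD_le.
  rewrite (le_trans (padic_exp_linear_le p_prime vabs_p complete (vabs_log_mul_lt x1)))//.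
  apply: ler_wpM2r; first by rewrite invr_ge0 ltW.
  by rewrite lerXn2r ?nnegrE ?vabs_ge0// vabs_log_mul_le.
rewrite vabsM (le_trans (ler_piMl (vabs_ge0 _) x1))//.
exact: padic_log_linear_le p_prime vabs_p complete _ q_near1.
Qed.

End QPowers.

Section QEulerBarnes.
Context {R : realType} {K : valuedFieldType R} (p : nat).
Hypotheses (p_prime : prime p) (vabs_p : vabs (p%:R : K) = p%:R^-1).
Hypothesis complete :
  forall F : set_system K, ProperFilter F -> cauchy F -> cvg F.
Local Notation rho := (exp_radius R p).
Variables (u : K) (u_far : forall f : nat, (0 < f)%N -> 1 <= vabs (1 - u ^+ f)).
Variables (r n : nat) (a : 'I_r -> K) (w : K).
Hypotheses (a_le1 : forall j, vabs (a j) <= 1) (w_le1 : vabs w <= 1).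

Let a_nat_le1 (x : 'I_r -> nat) j : vabs (a j * (x j)%:R) <= 1.
Proof. by rewrite vabsM mulr_ile1 ?vabs_ge0 ?vabs_nat_le1. Qed.

Let affine_le1 (x : 'I_r -> nat) : vabs (w + \sum_j a j * (x j)%:R) <= 1.
Proof. by apply: vabsD_le => //; apply: vabs_sum_le => // j _; exact: a_nat_le1. Qed.

(** For each [l], the power [q ^ (l (w + a . x))] is a constant times a product of
    exponentials in the coordinates of [x]; this is what makes the integral
    computable. *)
Lemma qEulerBarnes_integrandE (q : K) (x : 'I_r -> nat) : vabs (1 - q) < rho ->
  qEulerBarnes_integrand n w q a (fun j => (x j)%:R) =
  \sum_(l < n.+1) (1 - q) ^- n * ('C(n, l)%:R * (-1) ^+ l * padic_pow q (l%:R * w)) *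
     \prod_j padic_pow q (l%:R * a j) ^+ x j.
Proof.
move=> qr; rewrite /qEulerBarnes_integrand /qbracket expr_div_n exprDn mulrC mulr_sumr.
apply: eq_bigr => l _; rewrite expr1n mul1r [(- padic_pow q _) ^+ l]exprNn -mulr_natl -!mulrA.
congr (_ * (_ * (_ * _))) => /=.
rewrite (padic_powD p_prime vabs_p complete qr)//; last first.
  by apply: vabs_sum_le => // j _; exact: a_nat_le1.
rewrite (padic_pow_sum p_prime vabs_p complete qr _ (a_nat_le1 x)) exprMn.
rewrite (padic_pow_natM p_prime vabs_p complete qr)//; congr (_ * _).
rewrite -prodrXl; apply: eq_bigr => j _.
rewrite mulrC !(padic_pow_natM p_prime vabs_p complete qr)//.
by rewrite -!exprM mulnC.
Qed.

Lemma qEulerBarnes_sum_cvg (q : K) : vabs (1 - q) < rho ->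
  mu_sum p u (qEulerBarnes_integrand n w q a) @ \oo -->
  (1 - u) ^+ r / (1 - q) ^+ n *
  \sum_(l < n.+1) 'C(n, l)%:R * (-1) ^+ l * padic_pow q (l%:R * w) *
     (\prod_(j < r) (1 - padic_pow q (l%:R * a j) * u))^-1.
Proof.
move=> qr.
have la1 l j : vabs (l%:R * a j) <= 1.
  by rewrite vabsM mulr_ile1 ?vabs_ge0 ?vabs_nat_le1.
have zlt l j : vabs (1 - padic_pow q (l%:R * a j)) < 1.
  apply: le_lt_trans (padic_pow1_le p_prime vabs_p complete qr (la1 l j)) _.
  exact: lt_trans qr (exp_radius_lt1 p_prime).
have zX l j := padic_pow_expX_cvg p_prime vabs_p complete qr (la1 l j).
have := mu_sum_exponential_cvg p_prime u_far (fun l : 'I_n.+1 => zlt l)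
  (fun l : 'I_n.+1 => zX l) (fun x => qEulerBarnes_integrandE x qr).
congr (_ --> _); rewrite mulr_sumr; apply: eq_bigr => l _.
by rewrite big_split -expr_prod_ord -prodfV /=; ring.
Qed.

(** The bracket is uniformly close to its argument, raising to the [n]-th power
    is 1-Lipschitz on the unit ball, and the weights of [mu_u] do not enlarge the
    difference of the Riemann sums; the estimate then passes to the limit in
    [N]. *)
Lemma qEulerBarnes_le (q : K) : u != 0 -> q != 1 -> vabs (1 - q) < rho ->
  vabs (qEulerBarnes p n w u q a - EulerBarnes n w u^-1 a) <= vabs (1 - q) / rho.
Proof.
move=> u0 q1 qr; have rho0 := exp_radius_gt0 (R := R) p_prime.
have lim_q := qEulerBarnes_sum_cvg qr.
rewrite /qEulerBarnes /mu_integral (vlimn_eq lim_q).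
apply: (vabs_limB_le lim_q (mu_sum_power_cvg p_prime vabs_p u_far u0 (n := n) (w := w) (a := a))).
apply: nearW => N; apply: (mu_sumB_le p_prime u_far) => [|x].
  by rewrite divr_ge0 ?vabs_ge0 ?ltW.
have x1 := affine_le1 (fun j => nat_of_ord (x j)).
have qb := qbracket_le p_prime vabs_p complete qr q1 x1.
have bracket_le1 : vabs (qbracket (w + \sum_j a j * (x j)%:R) q) <= 1.
  rewrite -[qbracket _ q](subrK (w + \sum_j a j * (x j)%:R)).
  by apply: vabsD_le => //; rewrite (le_trans qb)// ler_pdivrMr// mul1r ltW.
exact: le_trans (vabs_exprB_le n bracket_le1 x1) qb.
Qed.

End QEulerBarnes.

Theorem theorem1 (R : realType) (p : nat) (hp : prime p) (K : valuedFieldType R)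
    (hK : is_Cp p K)
    (r : nat) (hr : (1 <= r)%N)
    (a : 'I_r -> K) (ha : forall j, padic_int (a j) /\ a j != 0)
    (w : K) (hw : padic_int w)
    (u : K) (hu : forall f : nat, (0 < f)%N -> 1 <= vabs (1 - u ^+ f)) :
  (forall q : K, q != 1 -> vabs (1 - q) < exp_radius R p ->
   forall n : nat,
     cvgn (mu_sum p u (qEulerBarnes_integrand n w q a)) /\
     qEulerBarnes p n w u q a =
       (1 - u) ^+ r / (1 - q) ^+ n *
       \sum_(l < n.+1) 'C(n, l)%:R * (-1) ^+ l * padic_pow q (l%:R * w) *
          (\prod_(j < r) (1 - padic_pow q (l%:R * a j) * u))^-1) /\
  (u != 0 ->
   forall n : nat,
     qEulerBarnes p n w u q a
       @[q --> within [set q : K | q != 1 /\ vabs (1 - q) < exp_radius R p]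
                      (nbhs (1 : K))]
     --> EulerBarnes n w u^-1 a).
Proof.
have [vabs_p complete _ _] := hK.
have a_le1 j : vabs (a j) <= 1 by have [[]] := ha j.
have w_le1 : vabs w <= 1 by have [] := hw.
split=> [q q1 qr n|u0 n].
  have lim_q := qEulerBarnes_sum_cvg hp vabs_p complete hu (n := n) a_le1 w_le1 qr.
  by split; [exact: cvgP lim_q | exact: vlimn_eq lim_q].
apply: (@vcvg_dominated _ _ _ _ _ _ _ (fun q => vabs (1 - q) / exp_radius R p)).
  apply: filterS (withinT _ _) => q [q1 qr].
  exact: (qEulerBarnes_le hp vabs_p complete hu n a_le1 w_le1 u0 q1 qr).
have -> : (0 : R) = 0 / exp_radius R p by rewrite mul0r.
apply: cvgMr_tmp; apply: cvg_within_filter.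
have := @vcvg_vabs _ _ _ (nbhs (1 : K)) _ id 1 cvg_id.
by under eq_fun do rewrite vabs_distC; exact.
Qed.
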